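(* For every integer $m\ge1$, the Binet polynomial $b_m(\alpha)$ can be expressed in terms of Bernoulli polynomials as $$b_m(\alpha)=(-1)^{m-1}\sum_{k=0}^{m-1}\frac{S_{m-1}^{(k)}(-1)^k}{(k+1)(k+2)}\left(B_{k+2}(\alpha)-\alpha^{k+2}+\tfrac12(k+2)\alpha^{k+1}\right).$$
   Context: $S_m^{(k)}$ denotes the (signed) Stirling number of the first kind, defined by $\prod_{k=0}^{m-1}(x-k)=\sum_{k=0}^{m}S_m^{(k)}x^k$ (with $S_0^{(0)}=1$). $B_n(\alpha)=\sum_{l=0}^{n}\binom nl B_l\,\alpha^{n-l}$ are the Bernoulli polynomials, with $B_l$ the Bernoulli numbers ($B_1=-\frac12$). For $m\ge1$ the Binet polynomial is $$b_m(\alpha)=\frac1m\sum_{k=1}^{m}\left\{\frac{\alpha^{k+2}-(\alpha-1)^{k+2}}{k+2}+\frac{\left(\frac12-\alpha\right)\left(\alpha^{k+1}-(\alpha-1)^{k+1}\right)}{k+1}\right\}(-1)^{k-m}S_m^{(k)},$$ equivalently $b_m(\alpha)=\frac1m\int_{\alpha-1}^{\alpha}\left(x+\frac12-\alpha\right)\prod_{k=0}^{m-1}(k+x)\,dx$. These are the coefficients of the factorial series $\mu(z)=\sum_{m\ge1}b_m(\alpha)/\prod_{k=0}^{m-1}(z+\alpha+k)$ of Binet's function $\mu(z)=\log\Gamma(z)-(z-\frac12)\log z+z-\frac12\log(2\pi)$, $\operatorname{Re}(z)>0$. *)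

(* Defs.v *)
From mathcomp Require Import all_boot all_order all_algebra.

Set Implicit Arguments.
Unset Strict Implicit.
Unset Printing Implicit Defensive.

Import Order.TTheory GRing.Theory Num.Theory.
Local Open Scope ring_scope.

(* Signed Stirling number of the first kind S_m^(k): the coefficient of X^k   *)
(* in the falling factorial X (X - 1) ... (X - (m - 1)).                      *)
Definition stirling1 (m k : nat) : int :=
  (\prod_(i < m) ('X - (i%:R)%:P) : {poly int})`_k.

(* The list [:: B_0; ...; B_n], built by solving                              *)
(* \sum_(i < n.+2) 'C(n.+2, i) * B_i = 0 for the last term B_(n.+1).          *)
Fixpoint bernoulli_seq (n : nat) : seq rat :=
  if n is n'.+1 then
    let s := bernoulli_seq n' in
    rcons s (- (\sum_(i < n) 'C(n.+1, i)%:R * s`_i) / n.+1%:R)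
  else [:: 1].

Definition bernoulli (n : nat) : rat := (bernoulli_seq n)`_n.

Lemma size_bernoulli_seq n : size (bernoulli_seq n) = n.+1.
Proof. by elim: n => //= n IHn; rewrite size_rcons IHn. Qed.

Lemma nth_bernoulli_seq n i : (i <= n)%N -> (bernoulli_seq n)`_i = bernoulli i.
Proof.
elim: n => [|n IHn]; first by case: i.
rewrite leq_eqVlt => /predU1P[-> // | lt_i_n] /=.
by rewrite nth_rcons size_bernoulli_seq lt_i_n IHn.
Qed.

Lemma bernoulli0 : bernoulli 0 = 1.
Proof. by []. Qed.

Lemma bernoulli1 : bernoulli 1 = - (2%:R)^-1.
Proof. by rewrite /bernoulli /= big_ord1. Qed.

Lemma bernoulli_sum n :
  \sum_(i < n.+1) 'C(n.+1, i)%:R * bernoulli i = (n == 0)%:R.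
Proof.
case: n => [|n]; first by rewrite big_ord1.
rewrite big_ord_recr /= {2}/bernoulli /= nth_rcons size_bernoulli_seq ltnn eqxx.
rewrite binSn mulrC divfK ?pnatr_eq0 //; apply/eqP.
rewrite subr_eq0; apply/eqP/eq_bigr => i _.
by rewrite nth_bernoulli_seq // -ltnS.
Qed.

Definition bernoulli_poly (R : numFieldType) (n : nat) (alpha : R) : R :=
  \sum_(0 <= l < n.+1) 'C(n, l)%:R * ratr (bernoulli l) * alpha ^+ (n - l).

(* The exponent k - m of the sign is an integer, nonpositive on the range.    *)
Definition binet_poly (R : numFieldType) (m : nat) (alpha : R) : R :=
  (m%:R)^-1 * \sum_(1 <= k < m.+1)
    ((alpha ^+ k.+2 - (alpha - 1) ^+ k.+2) / k.+2%:R
     + (2%:R^-1 - alpha) * (alpha ^+ k.+1 - (alpha - 1) ^+ k.+1) / k.+1%:R)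
    * (-1) ^ (k%:Z - m%:Z) * (stirling1 m k)%:~R.

(* Main.v *)
From HB Require Import structures.
Require Import Defs.
From mathcomp Require Import all_boot all_order all_algebra.
From mathcomp Require Import ring.

Import Order.TTheory GRing.Theory Num.Theory.
Local Open Scope ring_scope.

(* Let P_m(x) = x (x + 1) ... (x + m - 1) and let D p = p(x) - p(x - 1), so     *)
(* that D P_m = m P_(m-1).  If H'' = P_m, integrating by parts twice gives      *)
(*   m b_m(alpha) = (H'(alpha) + H'(alpha-1)) / 2 - (H(alpha) - H(alpha-1)).    *)
(* The right-hand side of the theorem is T(P_(m-1)), where T maps h'' to        *)
(*   W(h) = beta(h) - h(alpha) + h'(alpha) / 2                                  *)
(* and beta is the umbral functional x^n |-> B_n(alpha).  Since                 *)
(* beta(D h) = h'(alpha - 1), the value m T(P_(m-1)) = T((D H)'') = W(D H) is   *)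
(* the same expression.                                                         *)

(** Both sides are linear functionals of a polynomial, so each identity is checked on monomials
    ([eq_linear_polyXn]). The Bernoulli recurrence gives beta(D h) = h'(alpha - 1)
    ([bernoulli_poly_form_diff]), and W factors through h'' ([em_coef_deriv2]). Together they turn
    the Binet integral of p into T(D p) ([binet_em_form]); [rising_poly_diff] then lowers the index
    and cancels 1/m. *)

Definition coef_form {R : numFieldType} (c : nat -> R) (p : {poly R}) : R :=
  \sum_(i < size p) p`_i * c i.

Lemma coef_form_wide {R : numFieldType} (c : nat -> R) n (p : {poly R}) :
  (size p <= n)%N -> coef_form c p = \sum_(i < n) p`_i * c i.
Proof.
move=> le_p_n; rewrite /coef_form (big_ord_widen _ (fun i => p`_i * c i) le_p_n).
rewrite big_mkcond; apply: eq_bigr => i _; case: ltnP => // le_p_i.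
by rewrite nth_default // mul0r.
Qed.

Lemma coef_form_linear {R : numFieldType} (c : nat -> R) :
  linear_for *%R (coef_form c).
Proof.
move=> a p q; pose n := maxn (size (a *: p + q)) (maxn (size p) (size q)).
rewrite !(@coef_form_wide _ c n) ?leq_max ?leqnn ?orbT //.
rewrite mulr_sumr -big_split; apply: eq_bigr => i _ /=.
by rewrite coefD coefZ mulrDl mulrA.
Qed.

HB.instance Definition _ {R : numFieldType} (c : nat -> R) :=
  GRing.isLinear.Build R {poly R} R _ (coef_form c) (coef_form_linear c).

Lemma coef_formXn {R : numFieldType} (c : nat -> R) n :
  coef_form c 'X^n = c n.
Proof.
rewrite (@coef_form_wide _ c n.+1) ?size_polyXn // big_ord_recr /= big1 ?add0r.
  by rewrite coefXn eqxx mul1r.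
by move=> i _; rewrite coefXn ltn_eqF // mul0r.
Qed.

Lemma eq_linear_polyXn {R : numFieldType} (f g : {poly R} -> R) :
  linear_for *%R f -> linear_for *%R g ->
  (forall n, f 'X^n = g 'X^n) -> f =1 g.
Proof.
move=> lf lg eq_fg p.
pose F := GRing.isLinear.Build R {poly R} R *%R f lf.
pose G := GRing.isLinear.Build R {poly R} R *%R g lg.
pose f' : {linear {poly R} -> R | *%R} := HB.pack f F.
pose g' : {linear {poly R} -> R | *%R} := HB.pack g G.
rewrite -[f]/(f' : _ -> _) -[g]/(g' : _ -> _) -[p]coefK poly_def !linear_sum.
by apply: eq_bigr => i _; rewrite !linearZ /= eq_fg.
Qed.

Definition backward_diff {R : numFieldType} (p : {poly R}) : {poly R} :=
  p - (p \Po ('X - 1%:P)).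

Lemma backward_diff_linear {R : numFieldType} : linear (@backward_diff R).
Proof.
move=> a p q; rewrite /backward_diff linearP.
by rewrite opprD addrACA scalerBr.
Qed.

Lemma deriv_backward_diff {R : numFieldType} (p : {poly R}) :
  (backward_diff p)^`() = backward_diff p^`().
Proof. by rewrite /backward_diff derivB deriv_comp derivXsubC mulr1. Qed.

Lemma horner_backward_diff {R : numFieldType} (p : {poly R}) x :
  (backward_diff p).[x] = p.[x] - p.[x - 1].
Proof. by rewrite /backward_diff !hornerE horner_comp !hornerE. Qed.

Definition bernoulli_form {R : numFieldType} : {poly R} -> R :=
  coef_form (fun n => ratr (bernoulli n)).

(** Umbral form of the Bernoulli recurrence: on 'X^n, the binomial expansion loses its top term and
    leaves the sum of [bernoulli_sum]. *)
Lemma bernoulli_form_diff {R : numFieldType} (q : {poly R}) :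
  bernoulli_form (q \Po ('X + 1%:P)) - bernoulli_form q = q^`().[0].
Proof.
move: q; apply: eq_linear_polyXn => [a p q|a p q|n].
- rewrite comp_polyD comp_polyZ /bernoulli_form !linearP /=; ring.
- by rewrite linearP !hornerE.
rewrite comp_Xn_poly /bernoulli_form coef_formXn derivXn [_ + 1%:P]addrC exprDn linear_sum /=.
rewrite big_ord_recr /= subnn binn expr0 mulr1n mul1r coef_formXn addrK.
case: n => [|n]; first by rewrite big_ord0 mulr0n horner0.
rewrite hornerMn hornerXn expr0n -[RHS]mulr_natr.
(* The derivative of 'X^(n+1) at 0 is 1 if n = 0 and 0 otherwise. *)
transitivity (ratr (n == 0)%:R : R); last first.
  by case: n => [|n]; rewrite ?rmorph1 ?rmorph0 ?mulr1 ?mul0r.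
rewrite -bernoulli_sum rmorph_sum; apply: eq_bigr => i _.
rewrite -polyC_exp expr1n mul1r raddfMn /= coef_formXn.
by rewrite rmorphM /= ratr_nat mulr_natl.
Qed.

Definition bernoulli_poly_form {R : numFieldType} (alpha : R) (p : {poly R}) : R :=
  bernoulli_form (p \Po ('X + alpha%:P)).

Lemma bernoulli_poly_form_linear {R : numFieldType} (alpha : R) :
  linear_for *%R (bernoulli_poly_form alpha).
Proof.
move=> a p q.
by rewrite /bernoulli_poly_form comp_polyD comp_polyZ /bernoulli_form linearP.
Qed.

Lemma bernoulli_poly_formXn {R : numFieldType} (alpha : R) n :
  bernoulli_poly_form alpha 'X^n = bernoulli_poly n alpha.
Proof.
rewrite /bernoulli_poly_form comp_Xn_poly addrC exprDn.
rewrite /bernoulli_form linear_sum /bernoulli_poly big_mkord.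
apply: eq_bigr => i _; rewrite -polyC_exp mul_polyC raddfMn /= linearZ /=.
rewrite coef_formXn -mulr_natl; ring.
Qed.

(** This is [bernoulli_form_diff] for p translated by alpha - 1: one more unit shift gives the
    translate by alpha. *)
Lemma bernoulli_poly_form_diff {R : numFieldType} (alpha : R) p :
  bernoulli_poly_form alpha (backward_diff p) = p^`().[alpha - 1].
Proof.
have := bernoulli_form_diff (p \Po ('X + (alpha - 1)%:P)).
rewrite deriv_comp derivD derivX derivC addr0 mulr1 horner_comp !hornerE => <-.
rewrite /bernoulli_poly_form /backward_diff comp_polyB /bernoulli_form linearB /=.
rewrite -!comp_polyA.
have -> : ('X - 1%:P) \Po ('X + alpha%:P) = 'X + (alpha - 1)%:P :> {poly R}.
  by rewrite comp_polyB comp_polyX comp_polyC polyCB; ring.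
have -> : ('X + (alpha - 1)%:P) \Po ('X + 1%:P) = 'X + alpha%:P :> {poly R}.
  by rewrite comp_polyD comp_polyX comp_polyC polyCB; ring.
by [].
Qed.

(** The functional W above. *)
Definition em_form {R : numFieldType} (alpha : R) (p : {poly R}) : R :=
  bernoulli_poly_form alpha p - p.[alpha] + 2%:R^-1 * p^`().[alpha].

Definition em_coef {R : numFieldType} (alpha : R) (k : nat) : R :=
  (bernoulli_poly k.+2 alpha - alpha ^+ k.+2
    + 2%:R^-1 * k.+2%:R * alpha ^+ k.+1) / (k.+1%:R * k.+2%:R).

(** W kills 1 and 'X, because B_0 = 1 and B_1 = -1/2, so it depends on the second derivative
    only. *)
Lemma em_coef_deriv2 {R : numFieldType} (alpha : R) p :
  coef_form (em_coef alpha) p^`()^`() = em_form alpha p.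
Proof.
move: p; apply: eq_linear_polyXn => [a p q|a p q|n].
- by rewrite !linearP.
- rewrite /em_form bernoulli_poly_form_linear linearP !hornerE /=; ring.
rewrite /em_form bernoulli_poly_formXn.
have [-> | [-> | [k ->]]] : n = 0%N \/ n = 1%N \/ exists k, n = k.+2.
- by case: n => [|[|k]]; [left | right; left | right; right; exists k].
- rewrite derivXn mulr0n linear0 linear0 horner0 /bernoulli_poly big_nat1.
  by rewrite bernoulli0 rmorph1 !hornerE; ring.
- rewrite derivXn mulr1n expr0 derivC linear0 hornerC /bernoulli_poly.
  rewrite big_nat_recr //= big_nat1 bernoulli0 bernoulli1 rmorphN fmorphV rmorph_nat.
  by rewrite [ratr 1]rmorph1 !hornerE; field.
rewrite derivXn derivMn derivXn /= !raddfMn /= coef_formXn !hornerMn !hornerXn.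
rewrite /em_coef -mulrnA -[LHS]mulr_natr natrM divfK.
  by rewrite -[alpha ^+ _ *+ _]mulr_natl mulrA.
by rewrite mulf_neq0 ?pnatr_eq0.
Qed.

(** The integral of (x + 1/2 - alpha) x^k over [alpha - 1, alpha], in closed form. *)
Definition binet_coef {R : numFieldType} (alpha : R) (k : nat) : R :=
  (alpha ^+ k.+2 - (alpha - 1) ^+ k.+2) / k.+2%:R
  + (2%:R^-1 - alpha) * (alpha ^+ k.+1 - (alpha - 1) ^+ k.+1) / k.+1%:R.

Lemma binet_em_form {R : numFieldType} (alpha : R) p :
  coef_form (binet_coef alpha) p = coef_form (em_coef alpha) (backward_diff p).
Proof.
move: p; apply: eq_linear_polyXn => [||n]; first exact: coef_form_linear.
  by move=> a p q; rewrite backward_diff_linear linearP.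
have n1 : n.+1%:R != 0 :> R by rewrite pnatr_eq0.
have n2 : n.+2%:R != 0 :> R by rewrite pnatr_eq0.
(* A double antiderivative of 'X^n; the right-hand side becomes W(D h). *)
pose h : {poly R} := (n.+1%:R * n.+2%:R)^-1 *: 'X^(n.+2).
have h1 : h^`() = n.+1%:R^-1 *: 'X^(n.+1).
  rewrite /h derivZ derivXn -scaler_nat scalerA /=; congr (_ *: _).
  by rewrite invfM mulfVK.
have h2 : (h^`())^`() = 'X^n :> {poly R}.
  by rewrite h1 derivZ derivXn -scaler_nat scalerA mulVf ?scale1r.
rewrite -h2 -!deriv_backward_diff em_coef_deriv2 h2 coef_formXn.
rewrite /em_form bernoulli_poly_form_diff deriv_backward_diff.
rewrite !horner_backward_diff h1 /h !hornerZ !hornerXn /binet_coef.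
(* With the n-th powers and n + 1 made atoms, a rational identity remains. *)
rewrite !exprS; move: (alpha ^+ n) ((alpha - 1) ^+ n) => x y.
move: n1 n2; rewrite -[n.+2%:R]natr1; move: n.+1%:R => a a0 a1.
by field; rewrite a0 a1.
Qed.

Definition rising_poly (R : numFieldType) (m : nat) : {poly R} :=
  \prod_(i < m) ('X + (i%:R)%:P).

Lemma rising_polySr (R : numFieldType) m :
  rising_poly R m.+1 = rising_poly R m * ('X + m%:R%:P).
Proof. exact: big_ord_recr. Qed.

Lemma size_rising_poly (R : numFieldType) m : size (rising_poly R m) = m.+1.
Proof.
elim: m => [|m IHm]; first by rewrite /rising_poly big_ord0 size_poly1.
by rewrite rising_polySr size_Mmonic ?monicXaddC ?size_XaddC ?IHm ?addn2 //
  -size_poly_eq0 IHm.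
Qed.

(** P_(m+1)(x) = (x + m) P_m(x) and P_(m+1)(x - 1) = (x - 1) P_m(x). *)
Lemma rising_poly_diff (R : numFieldType) m :
  backward_diff (rising_poly R m.+1) = m.+1%:R *: rising_poly R m.
Proof.
have shiftP n : rising_poly R n.+1 \Po ('X - 1%:P)
    = ('X - 1%:P) * rising_poly R n.
  elim: n => [|n IHn].
    rewrite rising_polySr /rising_poly !big_ord0 mul1r mulr1.
    by rewrite comp_polyD comp_polyX comp_polyC polyC0 addr0.
  rewrite rising_polySr comp_polyM IHn comp_polyD comp_polyX comp_polyC.
  by rewrite rising_polySr -mulrA -[n.+1%:R]natr1 polyCD; ring.
rewrite /backward_diff shiftP rising_polySr -mul_polyC -[m.+1%:R]natr1 polyCD.
ring.
Qed.

(** P_m(x) is (-1)^m times the falling factorial at -x; the proof compares the recurrences in m. *)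
Lemma coef_rising_poly (R : numFieldType) m k :
  (rising_poly R m)`_k = (-1) ^+ (m + k) * (stirling1 m k)%:~R.
Proof.
elim: m k => [|m IHm] k.
  rewrite /rising_poly /stirling1 !big_ord0 !coef1.
  by case: k => [|k]; rewrite ?mulr1 ?mulr0 //= expr0.
rewrite rising_polySr mulrDr coefD coefMX coefMC !IHm.
have -> : stirling1 m.+1 k
    = (if k == 0%N then 0 else stirling1 m k.-1) - stirling1 m k * m%:R.
  by rewrite /stirling1 big_ord_recr /= mulrBr coefB coefMX coefMC.
rewrite rmorphB rmorphM /= rmorph_nat.
case: k => [|k] /=; first by rewrite !addSn exprS; ring.
by rewrite !addSn !addnS !exprS; ring.
Qed.

Lemma signz_sub (R : numFieldType) (k m : nat) :
  (-1 : R) ^ (k%:Z - m%:Z) = (-1) ^+ (m + k).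
Proof.
rewrite expfzDr ?oppr_eq0 ?oner_eq0 // -exprnP -exprnN.
by rewrite -exprVn invrN1 mulrC -exprD.
Qed.

Lemma binet_poly_form (R : numFieldType) m (alpha : R) :
  binet_poly m.+1 alpha
  = m.+1%:R^-1 * coef_form (binet_coef alpha) (rising_poly R m.+1).
Proof.
rewrite (@coef_form_wide _ _ m.+2) ?size_rising_poly // /binet_poly.
congr (_ * _); rewrite -(big_mkord xpredT (fun i => _`_i * binet_coef alpha i)).
(* The factor 'X of P_(m+1) makes the constant coefficient vanish, so the sum may start at k = 1. *)
rewrite [RHS]big_ltn // [X in X * _](_ : _ = 0) ?mul0r ?add0r.
  apply: eq_bigr => k _; rewrite coef_rising_poly signz_sub /binet_coef; ring.
by rewrite /rising_poly big_ord_recl addr0 -mulrC coefMX.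
Qed.

Theorem mainTheorem9 (R : numFieldType) (m : nat) (alpha : R) (hm : (1 <= m)%N) :
  binet_poly m alpha =
  (-1) ^+ (m - 1) * \sum_(0 <= k < m)
    (stirling1 (m - 1) k)%:~R * (-1) ^+ k / (k.+1%:R * k.+2%:R)
    * (bernoulli_poly k.+2 alpha - alpha ^+ k.+2
       + 2%:R^-1 * k.+2%:R * alpha ^+ k.+1).
Proof.
case: m hm => // m _; rewrite subn1 /= binet_poly_form binet_em_form.
rewrite rising_poly_diff linearZ /= mulKf ?pnatr_eq0 //.
rewrite (@coef_form_wide _ _ m.+1) ?size_rising_poly // big_mkord mulr_sumr.
apply: eq_bigr => k _; rewrite coef_rising_poly exprD /em_coef.
by move: (_ * _)^-1 => d; ring.
Qed.
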